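(* There is a positive equivalence relation $\eta$ for which there is an $\eta$-family consisting of $\eta$-finite sets that is confidently learnable but not class-preservingly confidently learnable.
   Context: A positive equivalence relation is an equivalence relation $\eta$ on $\mathbb{N}$ that is recursively enumerable (as a set of pairs) and has infinitely many equivalence classes. A set is $\eta$-closed if it is a union of $\eta$-classes and $\eta$-finite if it is a union of finitely many $\eta$-classes. An $\eta$-family is an infinite family of $\eta$-closed sets possessing a uniformly r.e. one-one numbering $B_0,B_1,\dots$ (i.e. $\{\langle k,x\rangle:x\in B_k\}$ is r.e. and $B_i\neq B_j$ for $i\ne j$). $W_0,W_1,\dots$ is a fixed acceptable numbering of the r.e. sets. A text for $L$ is a total $T:\mathbb N\to\mathbb N\cup\{\#\}$ whose range minus $\{\#\}$ is $L$; $T[n]$ is its initial segment of length $n$. A learner is a recursive function $M$ from finite sequences over $\mathbb N\cup\{\#\}$ to $\mathbb N\cup\{?\}$. By default an output $e$ is interpreted as the hypothesis ''the $\eta$-closure of $W_e$''. Relative to an interpretation of hypotheses, $M$ confidently learns $\mathcal C$ if on every text $T$ for every $L\in\mathcal C$ it outputs from some point on a single index whose hypothesis equals $L$, and on every text for every set $L\subseteq\mathbb N$ the sequence $M(T[n])$ converges. $\mathcal C$ is class-preservingly confidently learnable if there is a uniformly r.e. hypothesis space $H_0,H_1,\dots$ with $\{H_i:i\in\mathbb N\}=\mathcal C$ and a learner that confidently learns $\mathcal C$ when each output $i$ is interpreted as $H_i$. *)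

(* Defs.v *)
From Stdlib Require Import RelationClasses.
From mathcomp Require Import all_boot.
From mathcomp Require Import boolp classical_sets functions cardinality.

Set Implicit Arguments.
Unset Strict Implicit.
Unset Printing Implicit Defensive.

Local Open Scope classical_set_scope.

(* The total recursive functions of all arities, as the least class containing
   the initial functions and closed under composition, primitive recursion and
   minimization of regular functions (those having a zero for all values of the
   parameters).  The defined function is characterized pointwise, so that the
   class is closed under extensional equality. *)
Inductive recursive_fun : forall n, (n.-tuple nat -> nat) -> Prop :=
| rec_zero (h : 0.-tuple nat -> nat) :
    (forall v, h v = 0) -> recursive_fun h
| rec_succ (h : 1.-tuple nat -> nat) :
    (forall x, h [tuple x] = x.+1) -> recursive_fun h
| rec_proj n (i : 'I_n) (h : n.-tuple nat -> nat) :
    (forall v, h v = tnth v i) -> recursive_fun h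
| rec_comp m n (f : m.-tuple nat -> nat) (g : 'I_m -> n.-tuple nat -> nat)
    (h : n.-tuple nat -> nat) :
    recursive_fun f -> (forall i, recursive_fun (g i)) ->
    (forall v, h v = f [tuple g i v | i < m]) -> recursive_fun h
| rec_prim n (f : n.-tuple nat -> nat) (g : n.+2.-tuple nat -> nat)
    (h : n.+1.-tuple nat -> nat) :
    recursive_fun f -> recursive_fun g ->
    (forall v : n.-tuple nat, h [tuple of 0 :: v] = f v) ->
    (forall k (v : n.-tuple nat), h [tuple of k.+1 :: v]
                 = g [tuple of k :: h [tuple of k :: v] :: v]) ->
    recursive_fun h
| rec_mu n (f : n.+1.-tuple nat -> nat) (h : n.-tuple nat -> nat) :
    recursive_fun f ->
    (forall v : n.-tuple nat, f [tuple of h v :: v] = 0 /\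
               (forall k, k < h v -> f [tuple of k :: v] <> 0)) ->
    recursive_fun h.

Definition recursive1 (f : nat -> nat) : Prop :=
  recursive_fun (fun v : 1.-tuple nat => f (tnth v ord0)).

(* r.e. = projection of a recursive relation, the latter being the zero set of
   a recursive function. *)
Definition re n (A : set (n.-tuple nat)) : Prop :=
  exists2 f : n.+1.-tuple nat -> nat, recursive_fun f &
    forall v : n.-tuple nat, A v <-> exists k, f [tuple of k :: v] = 0.

Definition re2 (P : nat -> nat -> Prop) : Prop :=
  re [set v : 2.-tuple nat | P (nth 0 v 0) (nth 0 v 1)].

Definition uniformly_re (B : nat -> set nat) : Prop :=
  re2 (fun k x => B k x).

(* Every uniformly r.e. sequence of sets reduces effectively to W; in
   particular W enumerates all the r.e. sets. *)
Definition acceptable (W : nat -> set nat) : Prop :=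
  uniformly_re W /\
  forall V : nat -> set nat, uniformly_re V ->
    exists2 f : nat -> nat, recursive1 f & forall i, V i = W (f i).

Section PositiveEquivalence.
Variable eta : nat -> nat -> Prop.

Definition eclass (x : nat) : set nat := [set y | eta x y].

Definition eclasses : set (set nat) := range eclass.

Definition positive_equivalence : Prop :=
  [/\ Equivalence eta, re2 eta & infinite_set eclasses].

Definition eta_closed (A : set nat) : Prop :=
  exists2 F : set (set nat), F `<=` eclasses & A = \bigcup_(X in F) X.

(* The empty set, a union of zero classes, is eta-finite. *)
Definition eta_finite (A : set nat) : Prop :=
  exists F : set (set nat),
    [/\ F `<=` eclasses, finite_set F & A = \bigcup_(X in F) X].

Definition eta_closure (A : set nat) : set nat := \bigcup_(x in A) eclass x.

Definition eta_family (C : set (set nat)) : Prop :=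
  [/\ infinite_set C,
      forall A, C A -> eta_closed A &
      exists B : nat -> set nat,
        [/\ uniformly_re B, injective B & range B = C] ].

End PositiveEquivalence.

(* [option nat] is both N together with the pause symbol # (for data) and N
   together with the symbol ? (for outputs); [None] is # resp. ?. *)
Definition text (T : nat -> option nat) (L : set nat) : Prop :=
  [set x | exists n, T n = Some x] = L.

Definition initial_segment (T : nat -> option nat) (n : nat) :
  seq (option nat) := mkseq T n.

Definition code_opt (o : option nat) : nat := if o is Some x then x.+1 else 0.

(* [CodeSeq.code] is an effective bijection from [seq nat] to [nat], hence
   [code_seq] is an effective bijection from [seq (option nat)] to [nat]. *)
Definition code_seq (s : seq (option nat)) : nat :=
  CodeSeq.code (map code_opt s).

Definition learner (M : seq (option nat) -> option nat) : Prop :=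
  exists2 f : nat -> nat, recursive1 f &
    forall s, code_opt (M s) = f (code_seq s).

Definition converges_to (M : seq (option nat) -> option nat)
    (T : nat -> option nat) (o : option nat) : Prop :=
  exists n0, forall n, n0 <= n -> M (initial_segment T n) = o.

(* [hyp e] is the set denoted by the output e.  On texts for sets outside C the
   limit may be any element of N with ? adjoined. *)
Definition confidently_learns (hyp : nat -> set nat)
    (M : seq (option nat) -> option nat) (C : set (set nat)) : Prop :=
  (forall L T, C L -> text T L ->
     exists2 e, converges_to M T (Some e) & hyp e = L) /\
  (forall L T, text T L -> exists o, converges_to M T o).

Definition confidently_learnable (W : nat -> set nat)
    (eta : nat -> nat -> Prop) (C : set (set nat)) : Prop :=
  exists2 M, learner M &
    confidently_learns (fun e => eta_closure eta (W e)) M C.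

Definition class_preservingly_confidently_learnable
    (C : set (set nat)) : Prop :=
  exists H : nat -> set nat,
    [/\ uniformly_re H, range H = C &
        exists2 M, learner M & confidently_learns H M C].

(* Main.v *)
(* The equivalence is equality.  Call 2k+1 the marker of k, where k = pr e s codes
   a pair.  Requirement e is a text T_e that starts with the element coded by
   pr e 0 and repeats its current element 2k, k = pr e t, until W_e is seen to
   contain (a pair coding) the marker of k and some initial segment of T_e; then,
   at stage s say, it moves on to the element coded by pr e s.  The family has one
   set B_k for each k: the elements enumerated by T_e up to stage t, plus the marker
   of k as soon as W_e contains 2k or 2k+1 together with some initial segment of
   T_e.  If T_e never takes the value 2k, then B_k is just {2k+1}.
   A confident learner conjectures B_k for the first marker 2k+1 that it sees and,
   before that, range T_e for the first element of block e.
   Suppose that H and M learn the family class-preservingly, and let W_e consist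
   of the pairs (sigma, y) with y in H_{M(sigma)}.  If T_e stabilises at 2k, then
   either B_k = range T_e, so that learning it puts 2k into W_e and hence the marker
   into B_k; or some H_{M(sigma)} contains 2k or 2k+1, hence equals B_k and
   contains the marker, so that T_e moves on.  If T_e does not stabilise, then every
   move is due to a hypothesis of M on T_e containing the current marker; as no set
   of the family has two markers, M makes infinitely many conjectures on T_e. *)

Require Import Defs.
From mathcomp Require Import all_boot.
From mathcomp Require Import boolp classical_sets cardinality.
From mathcomp Require Import zify.

Set Implicit Arguments.
Unset Strict Implicit.
Unset Printing Implicit Defensive.

Local Open Scope classical_set_scope.

(** * Closure properties of the recursive functions *)

(** Arguments are read off a list by [nth 0], so that recursiveness follows the syntax of a term
    without any handling of tuples. *)
Definition rc n (F : seq nat -> nat) : Prop :=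
  recursive_fun (fun v : n.-tuple nat => F v).

Definition rec1 (f : nat -> nat) : Prop := rc 1 (fun v => f (nth 0 v 0)).
Definition rec2 (f : nat -> nat -> nat) : Prop :=
  rc 2 (fun v => f (nth 0 v 0) (nth 0 v 1)).
Definition rec3 (f : nat -> nat -> nat -> nat) : Prop :=
  rc 3 (fun v => f (nth 0 v 0) (nth 0 v 1) (nth 0 v 2)).

Lemma rc_ext n F G : rc n F -> F =1 G -> rc n G.
Proof. by move=> rF /funext <-. Qed.

Lemma rc_var n i : i < n -> rc n (fun v => nth 0 v i).
Proof. by move=> lin; apply: (@rec_proj n (Ordinal lin)) => v; rewrite (tnth_nth 0). Qed.

Lemma rc1 n f F : rec1 f -> rc n F -> rc n (fun v => f (F v)).
Proof.
move=> rf rF; apply: (rec_comp rf (g := fun _ v => F v)) => // v.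
by rewrite (nth_mktuple _ _ (@Ordinal 1 0 isT)).
Qed.

Lemma rc2 n f F G : rec2 f -> rc n F -> rc n G -> rc n (fun v => f (F v) (G v)).
Proof.
move=> rf rF rG.
apply: (rec_comp rf (g := fun i v => nth 0 [:: F v; G v] i)) => [|v].
  by case=> [[|[|]]].
by rewrite (nth_mktuple _ _ (@Ordinal 2 0 isT)) (nth_mktuple _ _ (@Ordinal 2 1 isT)).
Qed.

Lemma rc3 n f F G K : rec3 f -> rc n F -> rc n G -> rc n K ->
  rc n (fun v => f (F v) (G v) (K v)).
Proof.
move=> rf rF rG rK.
apply: (rec_comp rf (g := fun i v => nth 0 [:: F v; G v; K v] i)) => [|v].
  by case=> [[|[|[|]]]].
by rewrite (nth_mktuple _ _ (@Ordinal 3 0 isT)) (nth_mktuple _ _ (@Ordinal 3 1 isT))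
  (nth_mktuple _ _ (@Ordinal 3 2 isT)).
Qed.

Lemma recursive1E f : recursive1 f <-> rec1 f.
Proof.
suff -> : rec1 f = recursive1 f by [].
by congr recursive_fun; apply/funext => v; rewrite (tnth_nth 0).
Qed.

Lemma rec_S : rec1 S.
Proof. by apply: rec_succ. Qed.

Lemma rc_const n c : rc n (fun=> c).
Proof.
have r0 : recursive_fun (fun _ : 0.-tuple nat => 0) by apply: rec_zero.
elim: c => [|c IHc]; last exact: rc1 rec_S IHc.
by apply: (rec_comp r0 (g := fun _ _ => 0)) => // - [].
Qed.

Lemma rec2_prim a b f : rec1 a -> rec3 b ->
    (forall p, f 0 p = a p) -> (forall k p, f k.+1 p = b k (f k p) p) ->
  rec2 f.
Proof.
move=> ra rb f0 fS; apply: (rec_prim ra rb) => [v|k v] /=.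
  exact: f0.
exact: fS.
Qed.

Lemma rec1_prim a b f : rec2 b ->
  f 0 = a -> (forall k, f k.+1 = b k (f k)) -> rec1 f.
Proof.
move=> rb f0 fS.
have rf : rec2 (fun k _ => f k).
  apply: (@rec2_prim (fun=> a) (fun k r _ => b k r)) => //.
    exact: rc_const.
  by apply: (rc2 rb); apply: rc_var.
by apply: (rc2 rf _ (rc_const 1 0)); apply: rc_var.
Qed.

Lemma rec1_mu f m : rec2 f ->
  (forall p, f (m p) p = 0) -> (forall p k, k < m p -> f k p <> 0) -> rec1 m.
Proof. by move=> rf m0 mlt; apply: (rec_mu rf) => v; split=> [|k]; [apply: m0 | apply: mlt]. Qed.

Lemma rec_pred : rec1 predn.
Proof. by apply: (@rec1_prim 0 (fun k _ => k)) => //; apply: rc_var. Qed.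

Lemma rec_add : rec2 addn.
Proof.
apply: (@rec2_prim id (fun _ r _ => r.+1)) => //; first exact: rc_var.
by apply: rc1 rec_S _; apply: rc_var.
Qed.

Lemma rec_mul : rec2 muln.
Proof.
apply: (@rec2_prim (fun=> 0) (fun _ r p => p + r)) => //; first exact: rc_const.
by apply: rc2 rec_add _ _; apply: rc_var.
Qed.

Lemma rec_sub : rec2 subn.
Proof.
(* Primitive recursion runs on the first argument, hence the swap. *)
have rs : rec2 (fun x y => y - x).
  apply: (@rec2_prim id (fun _ r _ => r.-1)) => [||p|k p]; first exact: rc_var.
  - by apply: rc1 rec_pred _; apply: rc_var.
  - exact: subn0.
  - exact: subnS.
by apply: (rc2 rs); apply: rc_var.
Qed.

Lemma rec_double : rec1 double.
Proof.
apply: (@rec1_prim 0 (fun _ r => r.+2)) => //.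
by do 2!apply: rc1 rec_S _; apply: rc_var.
Qed.

Lemma rec_half : rec1 half.
Proof.
apply: (@rec1_prim 0 (fun k r => k - r)) => // [|k]; last lia.
by apply: rc2 rec_sub _ _; apply: rc_var.
Qed.

Lemma rec_odd : rec1 odd.
Proof.
apply: (@rec1_prim 0 (fun _ r => 1 - r)) => // [|k]; last lia.
by apply: rc2 rec_sub _ _; [apply: rc_const | apply: rc_var].
Qed.

Lemma rec_exp2 : rec1 (expn 2).
Proof.
apply: (@rec1_prim 1 (fun _ r => r.*2)) => // [|k]; last by rewrite expnS mul2n.
by apply: rc1 rec_double _; apply: rc_var.
Qed.

Lemma rc_eq n F G : rc n F -> rc n G -> rc n (fun v => F v == G v).
Proof.
move=> rF rG.
apply: (@rc_ext _ (fun v => 1 - ((F v - G v) + (G v - F v)))) => [|v]; last lia.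
apply: rc2 rec_sub (rc_const _ _) _.
by apply: rc2 rec_add _ _; apply: rc2 rec_sub _ _.
Qed.

Lemma rc_leq n F G : rc n F -> rc n G -> rc n (fun v => F v <= G v).
Proof. by move=> rF rG; apply: rc_eq (rc_const _ _); apply: rc2 rec_sub _ _. Qed.

Lemma rc_if n (P : seq nat -> bool) F G : rc n P -> rc n F -> rc n G ->
  rc n (fun v => if P v then F v else G v).
Proof.
move=> rP rF rG.
apply: (@rc_ext _ (fun v => P v * F v + (1 - P v) * G v)) => [|v]; last first.
  by case: (P v); lia.
apply: rc2 rec_add _ _; apply: rc2 rec_mul _ _ => //.
exact: rc2 rec_sub (rc_const _ _) _.
Qed.

Lemma rc_neg n (P : seq nat -> bool) : rc n P -> rc n (fun v => ~~ P v).
Proof.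
move=> rP; apply: (@rc_ext _ (fun v => if P v then 0 else 1)).
  exact: rc_if rP (rc_const _ _) (rc_const _ _).
by move=> v; case: (P v).
Qed.

Lemma rc_and n (P Q : seq nat -> bool) : rc n P -> rc n Q ->
  rc n (fun v => P v && Q v).
Proof.
move=> rP rQ; apply: (@rc_ext _ (fun v => if P v then Q v : nat else 0)).
  exact: rc_if rP rQ (rc_const _ _).
by move=> v; case: (P v).
Qed.

Lemma rc_or n (P Q : seq nat -> bool) : rc n P -> rc n Q ->
  rc n (fun v => P v || Q v).
Proof.
move=> rP rQ; apply: (@rc_ext _ (fun v => if P v then 1 else Q v : nat)).
  exact: rc_if rP (rc_const _ _) rQ.
by move=> v; case: (P v).
Qed.

Lemma rc_if_bool n (P Q S : seq nat -> bool) : rc n P -> rc n Q -> rc n S ->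
  rc n (fun v => if P v then Q v else S v).
Proof.
move=> rP rQ rS.
apply: (@rc_ext _ (fun v => if P v then Q v : nat else S v)); first exact: rc_if.
by move=> v; case: (P v).
Qed.

Lemma rc_iter n f F G : rec1 f -> rc n F -> rc n G ->
  rc n (fun v => iter (F v) f (G v)).
Proof.
move=> rf; apply: (@rc2 _ (fun k x => iter k f x)).
apply: (@rec2_prim id (fun _ r _ => f r)) => //; first exact: rc_var.
by apply: rc1 rf _; apply: rc_var.
Qed.

Create HintDb rec.
#[local] Hint Resolve rec_S rec_pred rec_add rec_mul rec_sub rec_double rec_half
  rec_exp2 : rec.

Ltac rc_tac := lazymatch goal with
  | |- rc _ (fun v => nth 0 v _) => by apply: rc_var
  | |- rc _ (fun _ => ?c) => apply: rc_const
  | |- rc _ (fun v => nat_of_bool (odd _)) =>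
      apply: (rc1 rec_odd); rc_tac
  | |- rc _ (fun v => nat_of_bool (_ <= _)) => apply: rc_leq; rc_tac
  | |- rc _ (fun v => nat_of_bool (_ == _)) => apply: rc_eq; rc_tac
  | |- rc _ (fun v => nat_of_bool (~~ _)) => apply: rc_neg; rc_tac
  | |- rc _ (fun v => nat_of_bool (_ && _)) => apply: rc_and; rc_tac
  | |- rc _ (fun v => nat_of_bool (_ || _)) => apply: rc_or; rc_tac
  | |- rc _ (fun v => nat_of_bool (if _ then _ else _)) => apply: rc_if_bool; rc_tac
  | |- rc _ (fun v => if _ then _ else _) => apply: rc_if; rc_tac
  | |- rc ?n (fun v => iter (@?F v) ?f (@?G v)) =>
      apply: (@rc_iter n f F G); [solve [auto with rec] | rc_tac | rc_tac]
  | |- _ => first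
    [ lazymatch goal with |- rc ?n (fun v => ?f (@?F v)) =>
        apply: (@rc1 n f F); [solve [auto with rec] | rc_tac] end
    | lazymatch goal with |- rc ?n (fun v => ?f (@?F v) (@?G v)) =>
        apply: (@rc2 n f F G); [solve [auto with rec] | rc_tac | rc_tac] end
    | lazymatch goal with |- rc ?n (fun v => ?f (@?F v) (@?G v) (@?K v)) =>
        apply: (@rc3 n f F G K); [solve [auto with rec] | rc_tac | rc_tac | rc_tac] end
    ]
  end.
Ltac rec_tac := rewrite ?/rec1 ?/rec2 ?/rec3; rc_tac.

(** * Arithmetic of list codes and pairs *)

(** The formula by which [CodeSeq.code] puts a head on a list; the empty list has code 0. *)
Definition cns a c := 2 ^ a * c.*2.+1.
Definition hd c := head 0 (CodeSeq.decode c).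
Definition tl c := CodeSeq.code (behead (CodeSeq.decode c)).

Lemma hd_cns a c : hd (cns a c) = a.
Proof. by rewrite -(CodeSeq.decodeK c) /hd (CodeSeq.codeK (a :: _)). Qed.

Lemma tl_cns a c : tl (cns a c) = c.
Proof.
by rewrite -[in LHS](CodeSeq.decodeK c) /tl (CodeSeq.codeK (a :: _)) CodeSeq.decodeK.
Qed.

Lemma cnsK c : 0 < c -> cns (hd c) (tl c) = c.
Proof.
rewrite -(CodeSeq.decodeK c); case: (CodeSeq.decode c) => //= a l _.
by rewrite -/(cns a _) hd_cns tl_cns.
Qed.

Lemma iter_half_hd c k : 0 < c -> k <= hd c ->
  iter k half c = 2 ^ (hd c - k) * (tl c).*2.+1.
Proof.
move=> c0 lek; rewrite -{1}(cnsK c0) /cns -{1}(subnKC lek).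
move: (hd c - k) ((tl c).*2.+1) {lek} => a b.
by elim: k => // k IHk; rewrite iterSr addSn expnS -mulnA mul2n doubleK.
Qed.

Lemma rec_cns : rec2 cns.
Proof. rewrite /cns; rec_tac. Qed.

Lemma rec_hd : rec1 hd.
Proof.
(* The head is the 2-adic valuation, found by halving until the result is odd. The disjunct [c == 0]
   stops the search at once on 0, where [hd] is 0. *)
apply: (@rec1_mu (fun k c => ~~ ((c == 0) || odd (iter k half c)))) => [|c|c k].
- rec_tac.
- have [->|c0] := posnP c; first by [].
  by rewrite iter_half_hd // subnn mul1n oddS odd_double.
- have [->|c0] := posnP c; first by [].
  move=> ltk; rewrite iter_half_hd ?(ltnW ltk) //.
  by rewrite oddM oddX subn_eq0 leqNgt ltk.
Qed.
#[local] Hint Resolve rec_cns rec_hd : rec.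

Lemma rec_tl : rec1 tl.
Proof.
apply: (@rc_ext _ (fun v => (iter (hd (nth 0 v 0)) half (nth 0 v 0))./2)) => [|v].
  rec_tac.
have [->|c0] := posnP (nth 0 v 0); first by [].
by rewrite iter_half_hd // subnn mul1n /= uphalf_double.
Qed.
#[local] Hint Resolve rec_tl : rec.

Lemma rec_foldl g a : rec2 g -> rec1 (fun c => foldl g a (CodeSeq.decode c)).
Proof.
move=> rg.
(* A state combines the code of the remaining list with the accumulator; it is fixed once the list
   is empty. *)
pose step p := if hd p == 0 then p else cns (tl (hd p)) (g (tl p) (hd (hd p))).
have rstep : rec1 step by rewrite /step; rec_tac.
have iter_step l k x : size l <= k ->
    tl (iter k step (cns (CodeSeq.code l) x)) = foldl g x l.
  elim: l k x => [|b l IHl] k x /=.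
    by move=> _; elim: k => [|k IHk]; rewrite ?tl_cns // iterSr {2}/step hd_cns eqxx.
  case: k => // k lk; rewrite iterSr {2}/step hd_cns -/(cns b _) tl_cns hd_cns tl_cns.
  by rewrite eqn0Ngt muln_gt0 expn_gt0 IHl.
(* A code bounds the length of its list, so it can serve as the number of iterations. *)
have le_size l : size l <= CodeSeq.code l.
  elim: l => //= b l IHl; rewrite -[(size l).+1]mul1n leq_mul ?expn_gt0 //.
  by rewrite ltnS (leq_trans IHl) // -addnn leq_addr.
apply: (@rc_ext _ (fun v => tl (iter (nth 0 v 0) step (cns (nth 0 v 0) a)))) => [|v].
  rec_tac.
by rewrite -{2}(CodeSeq.decodeK (nth 0 v 0)) iter_step // -{2}(CodeSeq.decodeK (nth 0 v 0)).
Qed.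

(* [cns] omits exactly the value 0, so that [pr] is a bijection. *)
Definition pr a b := (cns a b).-1.
Definition fs p := hd p.+1.
Definition sn p := tl p.+1.

Lemma pr_cns a b : (pr a b).+1 = cns a b.
Proof. by rewrite prednK // muln_gt0 expn_gt0. Qed.

Lemma fs_pr a b : fs (pr a b) = a.
Proof. by rewrite /fs pr_cns hd_cns. Qed.

Lemma sn_pr a b : sn (pr a b) = b.
Proof. by rewrite /sn pr_cns tl_cns. Qed.

Lemma pr_fs_sn p : pr (fs p) (sn p) = p.
Proof. by rewrite /pr cnsK. Qed.

Lemma rec_pr : rec2 pr. Proof. rewrite /pr; rec_tac. Qed.
Lemma rec_fs : rec1 fs. Proof. rewrite /fs; rec_tac. Qed.

Lemma rec_sn : rec1 sn. Proof. rewrite /sn; rec_tac. Qed.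
#[local] Hint Resolve rec_pr rec_fs rec_sn : rec.

Lemma re2P (P : nat -> nat -> Prop) :
  re2 P <-> exists2 g, rec3 g & forall x y, P x y <-> exists k, g k x y = 0.
Proof.
split=> [[f rf fP]|[g rg gP]].
- exists (fun k x y => f [tuple k; x; y]) => [|x y]; last exact: (fP [tuple x; y]).
  congr recursive_fun: rf; apply/funext => v; congr f; apply/val_inj.
  by case: v => -[|a [|b [|c []]]].
- exists (fun v => g (nth 0 v 0) (nth 0 v 1) (nth 0 v 2)) => // v.
  exact: gP.
Qed.

(** * The texts T_e and the family of blocks *)

Section Construction.

Variable g : nat -> nat -> nat -> nat.
Hypothesis rec_g : rec3 g.

(* Stage [s] tries the triple (padding, n, j) coded by [s]; the padding makes
   every pair (n, j) come up again at arbitrarily late stages. *)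
Definition next e s c :=
  if g (sn (sn s)) e (pr (iter (s - fs (sn s)) tl c) (hd c).+1) == 0
  then (pr e s.+1).*2 else hd c.

(** Keeping the whole past of T_e in one code lets the recursion consult earlier initial
    segments. *)
Fixpoint hist e s :=
  if s is s'.+1 then cns (next e s' (hist e s')) (hist e s')
  else cns (pr e 0).*2 0.

Definition cur e s := hd (hist e s).

(** In the intended use [g j e z = 0] means that j witnesses z in W_e; here z pairs the first n+1
    values of T_e with y. *)
Definition query e n j y := g j e (pr (hist e n) y) == 0.

Definition marked k := exists n j,
  query (fs k) n j k.*2 || query (fs k) n j k.*2.+1.

(** T_e can take up [k.*2] only at stage [sn k], so a single value decides whether it ever does. *)
Definition block k : set nat := [set z |
  if cur (fs k) (sn k) == k.*2
  then (exists2 n, n <= sn k & cur (fs k) n = z) \/ z = k.*2.+1 /\ marked k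
  else z = k.*2.+1].

(** The index u is the datum on which the learner settles: a marker, or an element of block e. *)
Definition target u : set nat :=
  if odd u then block u./2 else range (cur (fs u./2)).

Lemma rec_hist : rec2 hist.
Proof.
have rh : rec2 (fun s e => hist e s).
  apply: (@rec2_prim (fun e => cns (pr e 0).*2 0) (fun s c e => cns (next e s c) c)) => //.
    rec_tac.
  rewrite /next; rec_tac.
by apply: (rc2 rh); apply: rc_var.
Qed.
#[local] Hint Resolve rec_hist : rec.

Lemma rec_cur : rec2 cur.
Proof. rewrite /cur; rec_tac. Qed.
#[local] Hint Resolve rec_cur : rec.

Lemma uniformly_re_target : uniformly_re target.
Proof.
(* The witness w codes a pair of a stage n and a query witness j. *)
apply/re2P; exists (fun w u z =>
  if odd u then
    if cur (fs u./2) (sn u./2) == u./2.*2 then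
      ~~ (((fs w <= sn u./2) && (cur (fs u./2) (fs w) == z)) ||
          ((z == u./2.*2.+1) && (query (fs u./2) (fs w) (sn w) u./2.*2
                              || query (fs u./2) (fs w) (sn w) u./2.*2.+1)))
    else ~~ (z == u./2.*2.+1)
  else ~~ (cur (fs u./2) (fs w) == z)) => [|u z].
  rewrite /query; rec_tac.
rewrite /target; case: (odd u); last first.
  split=> [[n _ <-]|[w]]; first by exists (pr n 0); rewrite fs_pr eqxx.
  by case: eqP => // <- _; exists (fs w).
move: (u./2) => k; rewrite /block /=; case: (_ == k.*2); last first.
  split=> [->|[w]]; first by exists 0; rewrite eqxx.
  by case: eqP.
split=> [[[n lenk <-]|[-> [n [j q]]]]|[w]].
- by exists (pr n 0); rewrite fs_pr lenk eqxx.
- by exists (pr n j); rewrite fs_pr sn_pr eqxx q orbT.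
case: orP => // -[/andP[le /eqP eqz]|/andP[/eqP -> q]] _; [left|right].
  by exists (fs w).
by split=> //; exists (fs w), (sn w).
Qed.

(** The stage at which T_e took up its present value. *)
Definition start e s := sn (cur e s)./2.

(** With n = [fs (sn s)], the double subtraction is the minimum of n and s: for n beyond s, [next]
    uses the entire history. *)
Definition advance e s :=
  query e (s - (s - fs (sn s))) (sn (sn s)) (cur e s).+1.

Lemma iter_tl_hist e s k : k <= s -> iter k tl (hist e s) = hist e (s - k).
Proof.
elim: k s => [|k IHk] s; first by rewrite subn0.
by case: s => // s lks; rewrite iterSr /= tl_cns IHk.
Qed.

Lemma curS e s :
  cur e s.+1 = if advance e s then (pr e s.+1).*2 else cur e s.
Proof. by rewrite /cur /= hd_cns /next iter_tl_hist ?leq_subr. Qed.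

Lemma curE e s : cur e s = (pr e (start e s)).*2.
Proof.
rewrite /start; elim: s => [|s IHs]; first by rewrite /cur hd_cns doubleK sn_pr.
by rewrite curS; case: ifP => _; rewrite ?doubleK ?sn_pr.
Qed.

Lemma startS e s : start e s.+1 = if advance e s then s.+1 else start e s.
Proof. by rewrite /start curS; case: ifP => // _; rewrite doubleK sn_pr. Qed.

Lemma start_le e s : start e s <= s.
Proof.
elim: s => [|s IHs]; first by rewrite /start /cur hd_cns doubleK sn_pr.
by rewrite startS; case: ifP => // _; apply: leqW.
Qed.

Lemma leq_start e s t : s <= t -> start e s <= start e t.
Proof.
elim: t => [|t IHt]; first by rewrite leqn0 => /eqP ->.
rewrite leq_eqVlt ltnS => /predU1P[-> //|/IHt /leq_trans]; apply.
by rewrite startS; case: ifP => // _; apply/leqW/start_le.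
Qed.

Lemma start_idem e s : start e (start e s) = start e s.
Proof.
elim: s => [|s IHs].
  have st0 : start e 0 = 0 by apply/eqP; rewrite -leqn0 start_le.
  by rewrite !st0.
by rewrite startS; case: ifP => // adv; rewrite startS adv.
Qed.

Lemma cur_eq_start k : (cur (fs k) (sn k) == k.*2) = (start (fs k) (sn k) == sn k).
Proof.
rewrite curE; apply/eqP/eqP => [/(congr1 half)|->]; last by rewrite pr_fs_sn.
by rewrite !doubleK => /(congr1 sn); rewrite sn_pr.
Qed.

(** T_e takes even values only, so a block has no odd element but its own marker. *)
Lemma block_odd k k' : block k k'.*2.+1 -> k' = k.
Proof.
rewrite /block /=; case: ifP => _; last by case=> /double_inj.
case=> [[n _ /(congr1 odd)]|[[/double_inj]] //].
by rewrite curE /= !odd_double.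
Qed.

Lemma block_double k k' : block k k'.*2 ->
  [/\ start (fs k) (sn k) = sn k, fs k' = fs k & sn k' <= sn k].
Proof.
rewrite /block /= cur_eq_start; case: eqP => [stk|_] => [[[n le]|[]]|]; last 2 first.
- by move=> /(congr1 odd); rewrite /= !odd_double.
- by move=> /(congr1 odd); rewrite /= !odd_double.
rewrite curE => /double_inj <-; rewrite fs_pr sn_pr; split=> //.
exact: leq_trans (start_le _ _) le.
Qed.

Lemma block_self k : cur (fs k) (sn k) = k.*2 -> block k k.*2.
Proof. by move=> ck; rewrite /block /= ck eqxx; left; exists (sn k). Qed.

(** A block that is a mere marker is identified by it. Otherwise each of two equal blocks contains
    the last text element of the other, which bounds the stages both ways. *)
Lemma block_inj : injective block.
Proof.
have neq k k' : block k = block k' -> cur (fs k) (sn k) <> k.*2 -> k = k'.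
  move=> eqB /eqP/negPf nst; apply: block_odd; rewrite -eqB.
  by rewrite /block /= nst.
move=> k k' eqB.
have [ck|nc] := pselect (cur (fs k) (sn k) = k.*2); last exact: neq eqB nc.
have [ck'|nc] := pselect (cur (fs k') (sn k') = k'.*2); last first.
  exact/esym/(neq _ _ (esym eqB)).
have [|_ efs le] := @block_double k' k; first by rewrite -eqB; apply: block_self.
have [|_ _ le'] := @block_double k k'; first by rewrite eqB; apply: block_self.
by rewrite -(pr_fs_sn k) -(pr_fs_sn k') efs (@anti_leq (sn k) (sn k')) // le.
Qed.

Lemma advance_marked e s : advance e s -> marked (pr e (start e s)).
Proof.
rewrite /advance curE => q.
by exists (s - (s - fs (sn s))), (sn (sn s)); rewrite fs_pr q orbT.
Qed.

(** Moving on from [k.*2] would mark k, so T_e stays there and its range is exhausted by stage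
    [sn k]. *)
Lemma block_unmarked k : cur (fs k) (sn k) = k.*2 -> ~ marked k ->
  block k = range (cur (fs k)).
Proof.
move=> ck nm.
have stab s : sn k <= s -> cur (fs k) s = k.*2.
  elim: s => [|s IHs]; first by rewrite leqn0 => /eqP <-.
  rewrite leq_eqVlt ltnS => /predU1P[<- //|/IHs cs]; rewrite curS cs.
  case: ifP => // /advance_marked; move: cs; rewrite curE => /double_inj -> //.
rewrite /block ck eqxx; apply/seteqP; split=> z /= [].
- by move=> [n _ <-]; exists n.
- by case.
move=> n _ <-; left; have [le|/ltnW/stab ->] := leqP n (sn k); first by exists n.
by exists (sn k).
Qed.

Lemma block_nonempty k : exists z, block k z.
Proof.
have [ck|/negPf nc] := eqVneq (cur (fs k) (sn k)) k.*2.
  by exists k.*2; apply: block_self.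
by exists k.*2.+1; rewrite /block /= nc.
Qed.

Lemma finite_block k : finite_set (block k).
Proof.
pose r := [seq cur (fs k) n | n <- iota 0 (sn k).+1] ++ [:: k.*2.+1].
apply: (@sub_finite_set _ _ [set` r]) => [z|]; last exact: finite_seq.
rewrite /block /=; case: ifP => _ => [[[n le <-]|[-> _]]|->]; rewrite /r mem_cat mem_seq1.
- by rewrite map_f // mem_iota ltnS le.
- by rewrite eqxx orbT.
- by rewrite eqxx orbT.
Qed.

(** * The confident learner *)

(** [code_opt] shifts data by one, so odd numbers have the nonzero even codes. *)
Definition marker c := (c != 0) && ~~ odd c.

(** From 0 the state changes at most twice, to the first datum and to the first marker; this gives
    confidence. *)
Definition pick_step p c :=
  if marker p then p else if marker c || (p == 0) then c else p.

Definition pick_code (s : seq (option nat)) :=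
  foldl pick_step 0 (map code_opt s).

Definition pick_learner (f : nat -> nat) (s : seq (option nat)) :=
  if pick_code s is x.+1 then Some (f x) else None.

Lemma pick_learner_recursive f : rec1 f -> learner (pick_learner f).
Proof.
move=> rf; have rp : rec2 pick_step by rewrite /pick_step /marker; rec_tac.
have rfold := @rec_foldl _ 0 rp.
pose F c := foldl pick_step 0 (CodeSeq.decode c).
have rF : rec1 F by [].
exists (fun c => if F c == 0 then 0 else (f (F c).-1).+1) => [|s].
  apply/recursive1E; rec_tac.
rewrite /pick_learner /F /code_seq CodeSeq.codeK -/(pick_code s).
by case: (pick_code s).
Qed.

Lemma pick_codeS T n : pick_code (initial_segment T n.+1) =
  pick_step (pick_code (initial_segment T n)) (code_opt (T n)).
Proof. by rewrite /pick_code /initial_segment mkseqS map_rcons foldl_rcons. Qed.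

Lemma pick_code_origin T n : pick_code (initial_segment T n) = 0 \/
  exists2 m, m < n & pick_code (initial_segment T n) = code_opt (T m).
Proof.
elim: n => [|n [IHn|[m ltm IHn]]]; first by left.
  rewrite pick_codeS IHn /pick_step orbT; right; exists n => //.
rewrite pick_codeS IHn /pick_step; right.
case: ifP => _; first by exists m => //; apply: leqW.
by case: ifP => _; [exists n | exists m => //; apply: leqW].
Qed.

Lemma pick_code_limit T : exists p n0,
  (forall n, n0 <= n -> pick_code (initial_segment T n) = p) /\
  ((p = 0 /\ forall n, T n = None) \/
   exists x, [/\ p = x.+1, exists m, T m = Some x &
              odd x \/ forall n y, T n = Some y -> ~~ odd y]).
Proof.
pose P n := pick_code (initial_segment T n).
have stable n0 : (forall n, pick_step (P n0) (code_opt (T n)) = P n0) ->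
    forall n, n0 <= n -> P n = P n0.
  move=> PS; elim=> [|n IHn]; first by rewrite leqn0 => /eqP ->.
  rewrite leq_eqVlt ltnS => /predU1P[<- //|/IHn Pn].
  by rewrite [LHS]pick_codeS -/(P n) Pn PS.
have origin n : P n <> 0 -> exists x m, P n = x.+1 /\ T m = Some x.
  move=> Pn0; have [//|[m _]] := pick_code_origin T n; rewrite -/(P n) => Pn.
  by move: Pn Pn0; case Tm: (T m) => [x|] // Pn _; exists x, m.
have [[n mn]|nom] := pselect (exists n, marker (code_opt (T n))).
  have mP : marker (P n.+1).
    by rewrite /P pick_codeS /pick_step; case: ifP => // _; rewrite mn.
  exists (P n.+1), n.+1; split.
    by apply: stable => m; rewrite /pick_step mP.
  have [x [m [Px Tm]]] : exists x m, P n.+1 = x.+1 /\ T m = Some x.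
    by apply: origin => P0; move: mP; rewrite P0.
  right; exists x; split=> //; first by exists m.
  by left; move: mP; rewrite Px /marker /= negbK.
have nomark n y : T n = Some y -> ~~ odd y.
  move=> Tn; apply/negP => oy; apply: nom; exists n.
  by rewrite Tn /marker /= negbK.
have [[n Tn]|noT] := pselect (exists n, T n <> None); last first.
  have TN n : T n = None by apply: contrapT => Tn; apply: noT; exists n.
  exists 0, 0; split=> [n _|]; last by left.
  by have [//|[m _ ->]] := pick_code_origin T n; rewrite TN.
have P0 : P n.+1 <> 0.
  rewrite /P pick_codeS /pick_step; case: ifP => [/andP[/eqP]//|_].
  by case: ifP => [_|/negbT/norP[_ /eqP]//]; case: (T n) Tn.
exists (P n.+1), n.+1; have [x [m [Px Tm]]] := origin _ P0; split; last first.
  by right; exists x; split=> //; [exists m | right].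
apply: stable => k; rewrite /pick_step Px orbF; case: ifP => // _; case: ifP => // mk.
by case: nom; exists k.
Qed.

Lemma pick_learner_confident f hyp : (forall u, hyp (f u) = target u) ->
  confidently_learns hyp (pick_learner f) (range block).
Proof.
move=> hypf; split=> [L T [k _ <-{L}] TL|_ T _]; last first.
  have [p [n0 [Pn _]]] := pick_code_limit T.
  by exists (if p is x.+1 then Some (f x) else None), n0 => n /Pn; rewrite /pick_learner => ->.
have in_block x n : T n = Some x -> block k x.
  by move=> Tn; rewrite -TL; exists n.
have [p [n0 [Pn [[_ TN]|[x [px [m Tm] cases]]]]]] := pick_code_limit T.
  by have [z] := block_nonempty k; rewrite -TL => -[n]; rewrite TN.
exists (f x); first by exists n0 => n /Pn; rewrite /pick_learner => ->; rewrite px.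
rewrite hypf /target; have Bx := in_block _ _ Tm.
case: ifPn => [ox|ex].
  have xE : x = x./2.*2.+1 by rewrite -[LHS]odd_double_half ox.
  by congr block; apply: block_odd; rewrite -xE.
have noodd z : block k z -> ~~ odd z.
  by case: cases => [|ev]; [rewrite (negPf ex) | rewrite -TL => -[n /ev]].
have xE : x = x./2.*2 by rewrite -[LHS]odd_double_half (negPf ex).
have [stk fsx _] : [/\ start (fs k) (sn k) = sn k, fs x./2 = fs k & sn x./2 <= sn k].
  by apply: block_double; rewrite -xE.
have ck : cur (fs k) (sn k) = k.*2 by apply/eqP; rewrite cur_eq_start stk.
(* Were k marked, its odd marker would occur in the text. *)
rewrite fsx block_unmarked // => mk.
have /noodd : block k k.*2.+1 by rewrite /block /= ck eqxx; right.
by rewrite /= odd_double.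
Qed.

(** * Diagonalization against class-preserving learners *)

(* Histories list the most recent entry first, initial segments list it last. *)
Definition reverse_code c :=
  foldl (fun acc x => cns x.+1 acc) 0 (CodeSeq.decode c).

Lemma reverse_code_hist e n :
  reverse_code (hist e n) = code_seq (initial_segment (Some \o cur e) n.+1).
Proof.
have -> : hist e n = CodeSeq.code (rev (mkseq (cur e) n.+1)).
  elim: n => [|n IHn]; first by rewrite /mkseq /= /cur hd_cns.
  by rewrite mkseqS rev_rcons /= -IHn /cur [in hd _]/= hd_cns.
rewrite /reverse_code CodeSeq.codeK foldl_rev /code_seq /initial_segment /mkseq.
by rewrite -map_comp; elim: (iota _ _) => //= b l ->.
Qed.

Lemma query_universal (W : nat -> set nat)
    (Wg : forall e z, W e z <-> exists j, g j e z = 0) e n y :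
  W e (pr (hist e n) y) <-> exists j, query e n j y.
Proof.
by rewrite Wg; split=> -[j q]; exists j; apply/eqP.
Qed.

End Construction.

(** Large padding thus forces a late stage. *)
Lemma leq_pr a b : a <= pr a b.
Proof.
by rewrite -ltnS pr_cns -[a.+1]muln1 leq_mul // ltn_expl.
Qed.

(** [f] computes the learner on codes: 0 stands for ?, and i.+1 for the output i. *)
Definition in_hypothesis (H : nat -> set nat) (f : nat -> nat) z :=
  f (reverse_code (fs z)) != 0 /\ H (f (reverse_code (fs z))).-1 (sn z).

Lemma uniformly_re_in_hypothesis H f : uniformly_re H -> rec1 f ->
  uniformly_re (fun _ : nat => in_hypothesis H f).
Proof.
move=> /re2P[h rh hH] rf; apply/re2P.
have rrev : rec1 reverse_code.
  have /rec_foldl : rec2 (fun acc x => cns x.+1 acc) by rec_tac.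
  exact.
exists (fun j _ z => if f (reverse_code (fs z)) == 0 then 1
                     else h j (f (reverse_code (fs z))).-1 (sn z)) => [|i z].
  rec_tac.
rewrite /in_hypothesis; case: eqP => [_|_].
  by split=> [[]//|[j]].
by split=> [[_ /hH]|/hH].
Qed.

Lemma range_block_not_class_preserving (W : nat -> set nat) g : acceptable W ->
    (forall e z, W e z <-> exists j, g j e z = 0) ->
  ~ class_preservingly_confidently_learnable (range (block g)).
Proof.
move=> [_ Wacc] Wg [H [reH rangeH [M [f /recursive1E rf Mf] [learns confident]]]].
(* A constant sequence of sets turns acceptability into an index e of this one set. *)
have [r _ /(_ 0)] := Wacc _ (uniformly_re_in_hypothesis reH rf).
move: (r 0) => e {r} We.
pose T := Some \o cur g e.
have queryE n y : (exists j, query g e n j y) <->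
    exists2 i, M (initial_segment T n.+1) = Some i & H i y.
  rewrite -(query_universal Wg) -We /in_hypothesis /= fs_pr sn_pr.
  rewrite reverse_code_hist -Mf; case: (M _) => [i|] /=.
    by split=> [[_ Hi]|[_ [<-] Hi]]; [exists i | split].
  by split=> [[]|[]].
have Hblock i : exists k, block g k = H i.
  by have [k _ kH] : range (block g) (H i); [rewrite -rangeH; exists i | exists k].
have textT : text T (range (cur g e)).
  by apply/seteqP; split=> z /= [n]; [move=> [<-]; exists n | move=> _ <-; exists n].
have [[t stab]|unstab] :=
  pselect (exists t, forall s, t <= s -> start g e s = start g e t).
- pose k := pr e (start g e t).
  have ck : cur g (fs k) (sn k) = k.*2 by rewrite fs_pr sn_pr curE start_idem.
  have mk : marked g k.
    (* If k is unmarked, T is a text for B_k, so the limit hypothesis of M contains [k.*2] and marks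
       k after all. *)
    apply: contrapT => nm; have := block_unmarked ck nm; rewrite fs_pr => Bk.
    have [||i [n0 Mi] Hi] := learns (block g k) T; first by exists k.
      by rewrite Bk.
    have [j q] : exists j, query g e n0 j k.*2.
      by apply/queryE; exists i; [apply: Mi | rewrite Hi; apply: block_self].
    by apply: nm; exists n0, j; rewrite fs_pr q.
  have [n [j]] := mk; rewrite fs_pr => q.
  have [i Mi HiE] : exists2 i, M (initial_segment T n.+1) = Some i & H i = block g k.
    case/orP: q => q.
      have /queryE[i Mi Hi] : exists j, query g e n j k.*2 by exists j.
      exists i => //; have [k' Bk'] := Hblock i.
      have [|stk' fsk' lek'] := @block_double g k' k; first by rewrite Bk'.
      rewrite fs_pr in fsk'; rewrite sn_pr in lek'; rewrite -fsk' in stk'.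
      rewrite -Bk' -(pr_fs_sn k') -fsk' -stk'; congr (block g (pr _ _)).
      (* T_e takes up the element of k' at stage [sn k'], no earlier than its final change, hence
         exactly then. *)
      have [/stab //|/ltnW/(leq_start g e)] := leqP t (sn k').
      by rewrite stk' => le; apply/eqP; rewrite eqn_leq le.
    have /queryE[i Mi Hi] : exists j, query g e n j k.*2.+1 by exists j.
    exists i => //; have [k' Bk'] := Hblock i.
    by rewrite -Bk'; congr block; apply/esym/(@block_odd g); rewrite Bk'.
  have [j' q'] : exists j, query g e n j k.*2.+1.
    by apply/queryE; exists i => //; rewrite HiE /block /= ck eqxx; right.
  (* The padding puts s past n, so the query really uses n, and past t, so advancing at s
     contradicts stability. *)
  pose s := pr (n + t) (pr n j').
  have les : n + t <= s by apply: leq_pr.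
  have := stab s (leq_trans (leq_addl _ _) les).
  have := stab s.+1 (leqW (leq_trans (leq_addl _ _) les)); rewrite startS.
  rewrite /advance sn_pr fs_pr sn_pr subKn ?(leq_trans (leq_addr _ _) les) // curE.
  move=> + st_s; rewrite st_s q' => st_eq; have := start_le g e t.
  by rewrite -st_eq leqNgt ltnS (leq_trans (leq_addl _ _) les).
- have [o [n0 Mo]] := confident _ _ textT.
  pose used s := s - (s - fs (sn s)).
  have markers s : advance g e s ->
      exists2 i, M (initial_segment T (used s).+1) = Some i & H i (cur g e s).+1.
    by move=> adv; apply/queryE; exists (sn (sn s)).
  (* Each hypothesis contains at most one marker, hence each initial segment
     justifies at most one advance. *)
  have advance_once s s' : advance g e s -> advance g e s' -> s < s' ->
      M (initial_segment T (used s).+1) <> M (initial_segment T (used s').+1).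
    move=> adv adv' lt; have [i -> Hi] := markers _ adv; have [i' -> Hi'] := markers _ adv'.
    case=> ii'; move: Hi Hi'; rewrite -ii'; have [k <-] := Hblock i.
    rewrite !curE => /block_odd <- /block_odd/(congr1 sn); rewrite !sn_pr => st.
    have := leq_start g e lt; rewrite startS adv st => /leq_trans/(_ (start_le _ _ _)).
    by rewrite ltnn.
  have later t : exists2 s, t <= s & advance g e s.
    apply: contrapT => nadv; apply: unstab; exists t; elim=> [|s IHs].
      by rewrite leqn0 => /eqP ->.
    rewrite leq_eqVlt ltnS => /predU1P[<- //|ts]; rewrite startS IHs //.
    by case: ifP => // adv; case: nadv; exists s.
  (* Each length is used by at most one advance, so late advances rest on long initial segments. *)
  have far m : exists t, forall s, t <= s -> advance g e s -> m <= used s.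
    elim: m => [|m [t IHm]]; first by exists 0.
    have [[s [ts adv usm]]|nos] :=
      pselect (exists s, [/\ t <= s, advance g e s & used s = m]).
      exists s.+1 => s' lts adv'; rewrite ltn_neqAle IHm ?andbT //; last first.
        by rewrite (leq_trans ts) // ltnW.
      apply/eqP => mE; apply: (advance_once _ _ adv adv' lts).
      by rewrite usm mE.
    exists t => s ts adv; rewrite ltn_neqAle IHm // andbT.
    by apply/eqP => mE; apply: nos; exists s.
  have [t tP] := far n0.
  have [s ts adv] := later t; have [s' ss' adv'] := later s.+1.
  apply: (advance_once _ _ adv adv' ss').
  by rewrite !Mo // leqW // tP // (leq_trans ts) // ltnW.
Qed.

(** * Assembly, with equality as the equivalence *)

Lemma infinite_range T (h : nat -> T) : injective h -> infinite_set (range h).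
Proof.
move=> injh; apply/infiniteP.
have := @inj_card_eq _ _ [set: nat] h (in2W injh).
by rewrite card_eq_le => /andP[].
Qed.

Theorem theorem11 :
  forall W : nat -> set nat, acceptable W ->
  exists eta : nat -> nat -> Prop,
    positive_equivalence eta /\
    exists C : set (set nat),
      [/\ eta_family eta C,
          forall A : set nat, C A -> eta_finite eta A,
          confidently_learnable W eta C &
          ~ class_preservingly_confidently_learnable C].
Proof.
move=> W accW; have [/re2P[g rg Wg] Wacc] := accW.
exists eq; split.
  split.
  - exact: RelationClasses.eq_equivalence.
  - apply/re2P; exists (fun _ x y => ~~ (x == y)) => [|x y]; first rec_tac.
    by split=> [->|[_]]; [exists 0; rewrite eqxx | case: eqP].
  - apply: infinite_range => x y xy.
    by have : eclass eq y y by []; rewrite -xy.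
(* The classes of equality are singletons, so every set is closed. *)
have bigcup_eq (A : set nat) : \bigcup_(X in eclass eq @` A) X = A.
  apply/seteqP; split=> [z [_ [x Ax <-]] <- //|z Az].
  by exists (eclass eq z) => //; exists z.
have target_re := uniformly_re_target rg.
exists (range (block g)); split.
- split=> [|A _|].
  + exact: infinite_range (@block_inj g).
  + by exists (eclass eq @` A); rewrite ?bigcup_eq // => _ [x _ <-]; exists x.
  + exists (block g); split=> //; last exact: (@block_inj g).
    have /re2P[h rh hP] := target_re; apply/re2P.
    (* The blocks are the entries of [target] at odd indices. *)
    exists (fun j k z => h j k.*2.+1 z) => [|k z]; first by rec_tac.
    by rewrite -hP /target /= odd_double uphalf_double.
- move=> _ [k _ <-]; exists (eclass eq @` block g k); split.
  + by move=> _ [x _ <-]; exists x.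
  + exact/finite_image/finite_block.
  + by rewrite bigcup_eq.
- have [f /recursive1E rf fP] := Wacc _ target_re.
  exists (pick_learner f); first exact: pick_learner_recursive.
  apply: pick_learner_confident => u; rewrite fP.
  apply/seteqP; split=> [z [x Wx <-] //|z Wz].
  by exists z.
- exact: range_block_not_class_preserving accW Wg.
Qed.
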